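(* Let $k$ be a nonnegative integer, let $k<\alpha<k+1$, and let $u$ be analytic on $[-1,1]$. Let $u_{NB}$ ($N\ge 2k+1$) be the two-point Hermite interpolant of $u$ with parameter $k$ defined in the context. Then $$\big\Vert {}^{R}D^{\alpha}(u-u_{NB})\big\Vert_{L^\infty[-1,1]}\le\frac{2C_R}{\Gamma(k+2-\alpha)}\big\Vert(u-u_{NB})^{(k+1)}\big\Vert_{L^\infty[-1,1]},$$ where $C_R=\max\{c_1,c_2\}$ with $c_1=\frac{1}{2\sin(\pi\gamma/2)}$, $c_2=\frac{1}{2\cos(\pi\gamma/2)}$ and $\gamma=k+1-\alpha$.
   Context: Riemann–Liouville integrals, for $\gamma\in(0,1)$: ${}_{-1}I_x^\gamma u(x)=\frac1{\Gamma(\gamma)}\int_{-1}^x\frac{u(\tau)}{(x-\tau)^{1-\gamma}}d\tau$ and ${}_xI_1^\gamma u(x)=\frac1{\Gamma(\gamma)}\int_x^1\frac{u(\tau)}{(\tau-x)^{1-\gamma}}d\tau$. Riesz potentials, for $\gamma\in(0,1)$: $I_o^\gamma u=c_1({}_{-1}I_x^\gamma-{}_xI_1^\gamma)u$ and $I_e^\gamma u=c_2({}_{-1}I_x^\gamma+{}_xI_1^\gamma)u$, where $c_1=\frac{1}{2\sin(\pi\gamma/2)}$, $c_2=\frac1{2\cos(\pi\gamma/2)}$. Riesz fractional derivative, for $\alpha\in(k,k+1)$, with $D=d/dx$: ${}^RD^\alpha u=D^{k+1}I_o^{k+1-\alpha}u$ if $k+1$ is odd, and ${}^RD^\alpha u=D^{k+1}I_e^{k+1-\alpha}u$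 if $k+1$ is even. $\mathcal{P}_N$ is the space of polynomials of degree at most $N$; $P_n^{a,b}$ is the classical Jacobi polynomial of degree $n$ (orthogonal on $[-1,1]$ with weight $(1-x)^a(1+x)^b$). Two-point Hermite interpolant: let $\tilde n=N-2k-1\ge 0$ and let $-1=x_0<x_1<\cdots<x_{\tilde n+1}=1$ be the distinct zeros of $(1-x)^{k+1}(1+x)^{k+1}P^{k+1,k+1}_{\tilde n}(x)$. $u_{NB}\in\mathcal{P}_N$ is the unique polynomial with $u_{NB}^{(j)}(\pm1)=u^{(j)}(\pm1)$ for $j=0,\dots,k$ and $u_{NB}(x_i)=u(x_i)$ for $i=1,\dots,\tilde n$. *)

(* Defs.v *)
From mathcomp Require Import all_boot all_order all_algebra.
From mathcomp Require Import all_classical all_reals all_analysis.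
Set Implicit Arguments.
Unset Strict Implicit.
Unset Printing Implicit Defensive.
Import Order.TTheory GRing.Theory Num.Theory.
Import numFieldNormedType.Exports.

Local Open Scope classical_set_scope.
Local Open Scope ring_scope.

Definition Gamma {R : realType} (z : R) : R :=
  Rintegral lebesgue_measure `]0, +oo[
    (fun t => t `^ (z - 1) * expR (- t)).

Definition RL_left {R : realType} (gamma : R) (u : R -> R) (x : R) : R :=
  (Gamma gamma)^-1 *
  Rintegral lebesgue_measure `[-1, x] (fun t => u t / (x - t) `^ (1 - gamma)).

Definition RL_right {R : realType} (gamma : R) (u : R -> R) (x : R) : R :=
  (Gamma gamma)^-1 *
  Rintegral lebesgue_measure `[x, 1] (fun t => u t / (t - x) `^ (1 - gamma)).

Definition riesz_c1 {R : realType} (gamma : R) : R :=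
  (2 * sin (pi * gamma / 2))^-1.

Definition riesz_c2 {R : realType} (gamma : R) : R :=
  (2 * cos (pi * gamma / 2))^-1.

Definition riesz_Io {R : realType} (gamma : R) (u : R -> R) (x : R) : R :=
  riesz_c1 gamma * (RL_left gamma u x - RL_right gamma u x).

Definition riesz_Ie {R : realType} (gamma : R) (u : R -> R) (x : R) : R :=
  riesz_c2 gamma * (RL_left gamma u x + RL_right gamma u x).

Definition riesz_potential {R : realType} (k : nat) (alpha : R) (u : R -> R) :
    R -> R :=
  if odd k.+1 then riesz_Io (k.+1%:R - alpha) u
  else riesz_Ie (k.+1%:R - alpha) u.

(* Meaningful for k < alpha < k + 1. *)
Definition riesz_deriv {R : realType} (k : nat) (alpha : R) (u : R -> R) :
    R -> R :=
  derive1n k.+1 (riesz_potential k alpha u).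

(* [derive1n] is a total operator; this says that the iterated derivative
   derive1n n f exists in the usual sense at every point of A. *)
Definition derivable_upto {R : realType} (n : nat) (f : R -> R) (A : set R) :=
  forall (j : nat) (x : R), (j < n)%N -> A x -> derivable (derive1n j f) x 1.

(* Each power series is required to represent u on a full neighbourhood of its
   centre, also at the end points -1 and 1. *)
Definition analytic_on {R : realType} (u : R -> R) (A : set R) :=
  forall x0 : R, A x0 ->
    exists (a : nat -> R) (r : R), 0 < r /\
      forall x : R, `|x - x0| < r -> pseries a (x - x0) @ \oo --> u x.

(* The L^infinity norm is an essential supremum, so the values of f at
   the end points -1 and 1 do not matter. *)
Definition Linfty_norm {R : realType} (f : R -> R) : \bar R :=
  Lnorm lebesgue_measure +oo%E (EFin \o (f \_ `[-1, 1])).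

(* Jacobi polynomial P_n^{a,b} with its usual normalisation
   P_n^{a,b}(1) = 'C(n + a, n), for natural number parameters a and b. *)
Definition jacobi {R : realType} (a b n : nat) : {poly R} :=
  \sum_(s < n.+1)
    ('C(n + a, n - s) * 'C(n + b, s))%:R *:
    ((2^-1 *: ('X - 1)) ^+ s * (2^-1 *: ('X + 1)) ^+ (n - s)).

Definition nodal_poly {R : realType} (k m : nat) : {poly R} :=
  (1 - 'X) ^+ k.+1 * (1 + 'X) ^+ k.+1 * jacobi k.+1 k.+1 m.

(* x 0 < ... < x m.+1 are the distinct zeros of [nodal_poly k m];
   the values x i with i > m.+1 are irrelevant. *)
Definition hermite_nodes {R : realType} (k m : nat) (x : nat -> R) :=
  [/\ x 0%N = -1,
      x m.+1 = 1,
      (forall i : nat, (i <= m)%N -> x i < x i.+1) &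
      (forall y : R, root (nodal_poly k m) y <->
                     exists2 i : nat, (i <= m.+1)%N & y = x i)].

Definition hermite_interpolant {R : realType} (k N : nat) (x : nat -> R)
    (u : R -> R) (p : {poly R}) :=
  [/\ (size p <= N.+1)%N,
      (forall j : nat, (j <= k)%N ->
         p^`(j).[-1] = derive1n j u (-1) /\
         p^`(j).[1] = derive1n j u 1) &
      (forall i : nat, (1 <= i <= N - 2 * k - 1)%N -> p.[x i] = u (x i))].

(* Main.v *)
Require Import Defs.
From mathcomp Require Import all_boot all_order all_algebra.
From mathcomp Require Import all_classical all_reals all_analysis.
From mathcomp Require Import measurable_realfun ess_sup_inf.
From mathcomp Require Import ring lra.
Set Implicit Arguments.
Unset Strict Implicit.
Unset Printing Implicit Defensive.
Import Order.TTheory GRing.Theory Num.Theory.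
Import numFieldNormedType.Exports.
Local Open Scope classical_set_scope.
Local Open Scope ring_scope.

(** Write e for the interpolation error, g := k + 1 - alpha, and e_j for the
    j-th derivative of e cut off to [-1, 1] (zero outside).  On ]-1, 1[ the
    Riesz potential of e is the convolution of e_0 with one integrable kernel
    W, a multiple of |s|^(g-1) or of sign(s) |s|^(g-1) truncated to [-2, 2];
    the truncation is invisible because x - t stays in [-2, 2].

    The Hermite conditions say that e_0, ..., e_k vanish at both end points, so
    that these functions are Lipschitz on the whole line and e_j' = e_(j+1)
    away from -1 and 1.  Derivatives therefore fall on the first factor,
    (e_j * W)' = e_(j+1) * W for j <= k, by dominated convergence: the
    difference quotients of a Lipschitz function are bounded by its constant,
    and two exceptional points do not matter.  No derivative ever hits the
    singular kernel, and no boundary term appears.  This is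
    [is_derive_convolution], iterated in [derive1n_convolution]; at the last
    step e_(k+1) may jump at the end points, which is harmless since it is only
    integrated.

    Hence the Riesz derivative is e_(k+1) * W on ]-1, 1[.  With M the essential
    supremum of e_(k+1) and c the constant c_1 or c_2, its absolute value at x
    is at most c M / Gamma(g) times the integral of |x - t|^(g-1) over [-1, 1],
    that is c M ((1 + x)^g + (1 - x)^g) / (g Gamma(g)).  By concavity of t^g the
    sum of the two powers is at most 2, and g Gamma(g) = Gamma(g + 1); see
    [norm_convolution_riesz_kernel].

    Analyticity enters through [analytic_smooth_near] only: near each point of
    [-1, 1], end points included, all iterated derivatives of e exist. *)

(** * Reflections of the line preserve Lebesgue measure *)

Lemma measurable_reflection {R : realType} (x : R) :
  measurable_fun [set: R] (fun s : R => x - s).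
Proof. exact: measurable_funB. Qed.

(** The map s |-> x - s is an involution that preserves the length of
    half-open intervals, which determines the measure.  Reflections, rather than
    translations, are what exchanges the two factors of a convolution. *)
Lemma lebesgue_measure_reflection {R : realType} (x : R) (A : set R) :
  measurable A ->
  pushforward lebesgue_measure ((fun s => x - s) : R -> measurableTypeR R) A =
  lebesgue_measure A.
Proof.
move=> mA; apply/esym/lebesgue_measure_unique => //=.
  exact: measurable_reflection.
move=> mr _ [[a b]] _ <-; rewrite /pushforward /=.
have -> : (fun s => x - s) @^-1` `]a, b] = `[x - b, x - a[%classic.
  apply/seteqP; split => s /=; rewrite !in_itv/= => /andP[? ?];
    by apply/andP; lra.
rewrite !lebesgue_measure_itv/= !lte_fin ltrD2l ltrN2.
by case: ifP => // _; rewrite -!EFinB; congr EFin; ring.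
Qed.

Lemma integral_reflection {R : realType} (x : R) (f : R -> \bar R) :
  measurable_fun [set: R] f ->
  (\int[lebesgue_measure]_s f (x - s)%R = \int[lebesgue_measure]_t f t)%E.
Proof.
have ge0 (g : R -> \bar R) : measurable_fun [set: R] g ->
    (forall t, 0 <= g t)%E ->
    (\int[lebesgue_measure]_s g (x - s)%R = \int[lebesgue_measure]_t g t)%E.
  move=> mg g0.
  have := @ge0_integral_pushforward _ _ (measurableTypeR R)
    (measurableTypeR R) R (fun s => x - s) (measurable_reflection x)
    lebesgue_measure setT g measurableT mg (fun t _ => g0 t).
  rewrite preimage_setT => <-.
  apply: eq_measure_integral => [|mr A mA _]; first exact: measurable_reflection.
  exact: lebesgue_measure_reflection.
move=> mf; rewrite integralE [RHS]integralE; congr (_ - _)%E.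
- rewrite -(ge0 _ (measurable_funepos mf)) ?funepos_ge0//.
  by apply: eq_integral => s _; rewrite funeposE funeposE.
- rewrite -(ge0 _ (measurable_funeneg mf)) ?funeneg_ge0//.
  by apply: eq_integral => s _; rewrite funenegE funenegE.
Qed.

Lemma integrable_reflection {R : realType} (x : R) (f : R -> R) :
  lebesgue_measure.-integrable setT (EFin \o f) ->
  lebesgue_measure.-integrable setT (EFin \o (fun s => f (x - s))).
Proof.
move=> /integrableP[mf ltf]; apply/integrableP; split.
  exact: (measurableT_comp mf (measurable_reflection x)).
have := integral_reflection x (measurableT_comp (@abse_measurable R setT) mf).
by rewrite /comp => ->.
Qed.

Lemma ae_reflection {R : realType} (x : R) (P : R -> Prop) :
  {ae lebesgue_measure, forall t, P t} ->
  {ae lebesgue_measure, forall s, P (x - s)}.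
Proof.
move=> [A [mA A0 PA]].
exists ((fun s => x - s) @^-1` A); split.
- by rewrite -[_ @^-1` _]setTI; exact: measurable_reflection.
- by have := lebesgue_measure_reflection x mA; rewrite /pushforward A0.
- by move=> s Ps; apply: PA.
Qed.

Lemma ae_imp {R : realType} (P Q : R -> Prop) :
  (forall t, P t -> Q t) -> {ae lebesgue_measure, forall t, P t} ->
  {ae lebesgue_measure, forall t, Q t}.
Proof.
move=> PQ [A [mA A0 PA]]; exists A; split => // t Qt.
by apply: PA => Pt; exact: Qt (PQ _ Pt).
Qed.

(** * Convolution with an integrable kernel *)

Definition convolution {R : realType} (f w : R -> R) (x : R) : R :=
  Rintegral lebesgue_measure setT (fun s => f (x - s) * w s).

Definition lipschitz_const {R : realType} (L : R) (f : R -> R) :=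
  forall x y, `|f x - f y| <= L * `|x - y|.

Lemma lipschitz_const_measurable {R : realType} (L : R) (f : R -> R) :
  lipschitz_const L f -> measurable_fun [set: R] f.
Proof.
move=> Lf; apply: continuous_measurable_fun => x.
apply/cvgrPdist_le => /= e e0; have L0 : 0 < `|L| + 1 by rewrite ltr_wpDl.
near=> t; rewrite (le_trans (Lf _ _))//.
rewrite (le_trans (y := (`|L| + 1) * `|x - t|))//.
  by apply: ler_wpM2r => //; rewrite (le_trans (ler_norm _))// lerDl.
rewrite -ler_pdivlMl//; near: t.
exists ((`|L| + 1)^-1 * e); first by rewrite /= mulr_gt0 ?invr_gt0.
by move=> y /= /ltW.
Unshelve. all: by end_near. Qed.

Lemma integrable_convolution {R : realType} (B : R) (f w : R -> R) (x : R) :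
  measurable_fun [set: R] f -> (forall t, `|f t| <= B) ->
  lebesgue_measure.-integrable setT (EFin \o w) ->
  lebesgue_measure.-integrable setT (EFin \o (fun s => f (x - s) * w s)).
Proof.
move=> mf fB iw.
apply: (le_integrable measurableT _ _ (integrableZl measurableT B iw)).
  apply/measurable_EFinP; apply: measurable_funM.
    exact: (measurableT_comp mf (measurable_reflection x)).
  by apply/measurable_EFinP; exact: (measurable_int _ iw).
move=> s _ /=; rewrite lee_fin !normrM ler_wpM2r// (le_trans (fB _))//.
exact: ler_norm.
Qed.

(** Difference quotients of f are bounded by L, so those of the convolution are
    dominated by L |w|; they converge at every s for which x - s avoids the
    negligible set E.  The kernel w may be unbounded and f need not be
    differentiable everywhere. *)
Lemma is_derive_convolution {R : realType} (L B : R) (E : set R)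
    (f g w : R -> R) (x : R) :
  lipschitz_const L f -> (forall t, `|f t| <= B) ->
  measurable_fun [set: R] g ->
  lebesgue_measure.-integrable setT (EFin \o w) ->
  lebesgue_measure.-negligible E ->
  (forall t, ~ E t -> is_derive t 1 f (g t)) ->
  is_derive x 1 (convolution f w) (convolution g w x).
Proof.
move=> Lf fB mg iw E0 fg.
have mf := lipschitz_const_measurable Lf.
have mw : measurable_fun [set: R] w.
  by apply/measurable_EFinP; exact: (measurable_int _ iw).
have ic y := integrable_convolution y mf fB iw.
pose c := convolution f w.
suff H : h^-1 *: (c (h + x) - c x) @[h --> 0^'] --> convolution g w x.
  have H' : h^-1 *: (c (h *: 1 + x) - c x) @[h --> 0^'] --> convolution g w x.
    rewrite (_ : (fun h => _) = (fun h => h^-1 *: (c (h + x) - c x)))//.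
    by apply/funext => h; rewrite [h *: 1]mulr1.
  by apply: DeriveDef; [exact: cvgP H'|exact: cvg_lim H'].
apply/cvgr_dnbhsP => t [t0 tcvg].
(* the integrand of the n-th difference quotient *)
pose q n s := (t n)^-1 * (f (t n + x - s) - f (x - s)) * w s.
have aeE : {ae lebesgue_measure, forall s, ~ E (x - s)}.
  apply: (ae_reflection x (P := fun t => ~ E t)).
  by apply: negligibleS E0 => y /= /contrapT.
have [|||||ig _ qg] := @dominated_convergence _ _ _ lebesgue_measure setT
   measurableT (fun n => EFin \o q n) (EFin \o (fun s => g (x - s) * w s))
   (fun s => L%:E * `|(w s)%:E|)%E.
- move=> n; apply/measurable_EFinP; apply: measurable_funM => //.
  apply: measurable_funM => //; apply: measurable_funB.
  + exact: (measurableT_comp mf (measurable_reflection _)).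
  + exact: (measurableT_comp mf (measurable_reflection _)).
- apply/measurable_EFinP; apply: measurable_funM => //.
  exact: (measurableT_comp mg (measurable_reflection _)).
- apply: ae_imp aeE => s /fg [dfs fs] _; apply: cvg_EFin; first exact: nearW.
  apply: cvgMl; rewrite -fs.
  have := dfs; rewrite /derivable => /cvgr_dnbhsP/(_ t (conj t0 tcvg)).
  rewrite (_ : (fun n => _) =
    (fun n => (t n)^-1 * (f (t n + x - s) - f (x - s))))//.
  by apply/funext => n /=; rewrite [_ *: 1]mulr1 -addrA.
- by apply: integrableZl => //; exact: integrable_abse.
- apply: aeW => s n _ /=; rewrite lee_fin /q normrM ler_wpM2r// normrM normfV.
  rewrite ler_pdivrMl ?normr_gt0// mulrC (le_trans (Lf _ _))//.
  by rewrite opprB addrA subrK addrK.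
have -> : (fun n => (t n)^-1 *: (c (t n + x) - c x)) =
    (fun n => fine (\int[lebesgue_measure]_s ((EFin \o q n) s))%E).
  apply/funext => n; rewrite /c /convolution -RintegralB//.
  rewrite [LHS]/GRing.scale/= -RintegralZl//; last first.
    exact: (integrableB measurableT (ic _) (ic _)).
  by congr fine; apply: eq_integral => s _ /=; congr EFin; rewrite /q; ring.
apply: fine_cvg; rewrite fineK//; exact: (integrable_fin_num measurableT ig).
Qed.

(** * Iterated derivatives and analytic functions *)

Section LocalDerivatives.
Context {R : realType}.
Implicit Types (f g : R -> R) (A : set R).

Lemma derive1n_eq_open f g A : open A -> {in A, f =1 g} ->
  forall j, {in A, derive1n j f =1 derive1n j g}.
Proof.
move=> oA fg; elim=> [//|j IH] x xA.
rewrite !derive1nS !derive1E; apply: near_eq_derive.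
have : nbhs x A by apply: open_nbhs_nbhs; split => //; exact: set_mem.
by apply: filterS => y Ay; apply: IH; exact: mem_set.
Qed.

Lemma derivable_upto_eq_open n f g A : open A -> {in A, f =1 g} ->
  derivable_upto n f A -> derivable_upto n g A.
Proof.
move=> oA fg df j x jn Ax; apply: near_eq_derivable (df j x jn Ax).
have : nbhs x A by apply: open_nbhs_nbhs; split.
by apply: filterS => y Ay; rewrite (derive1n_eq_open oA fg j) ?inE.
Qed.

Lemma derive1n_horner (p : {poly R}) j :
  derive1n j (horner p) = horner p^`(j).
Proof. by elim: j => // j IH; rewrite derive1nS IH derivnS derivE. Qed.

Lemma derive1nB_open f g A n : open A ->
  derivable_upto n f A -> derivable_upto n g A ->
  forall j, (j <= n)%N -> {in A, derive1n j (fun t => f t - g t) =1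
    (fun t => derive1n j f t - derive1n j g t)}.
Proof.
move=> oA df dg; elim=> [|j IH] jn x /set_mem Ax //.
rewrite !derive1nS !derive1E.
rewrite (@near_eq_derive _ _ _ _ (derive1n j f \- derive1n j g)).
  by rewrite deriveB//; [exact: df|exact: dg].
have : nbhs x A by apply: open_nbhs_nbhs; split.
by apply: filterS => y Ay; apply: (IH (ltnW jn)); exact: mem_set.
Qed.

End LocalDerivatives.

Section PowerSeries.
Context {R : realType}.
Implicit Types (a : R^nat) (r : R).

(** One term of the binomial expansion of (x + d)^(n+1).  It trades the factor
    n + 1 that differentiation puts on a power series for a slightly larger
    radius. *)
Lemma natmul_exp_le (x d : R) n : 0 <= x -> 0 <= d ->
  n.+1%:R * x ^+ n * d <= (x + d) ^+ n.+1.
Proof.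
move=> x0 d0; elim: n => [|n IH]; first by rewrite expr0 expr1; lra.
rewrite [(x + d) ^+ _]exprS [X in _ <= X]mulrDl [x ^+ n.+1]exprS.
have -> : n.+2%:R = n.+1%:R + 1 :> R by rewrite natr1.
rewrite (_ : _ * d = x * (n.+1%:R * x ^+ n * d) + d * (x * x ^+ n)).
  by rewrite lerD ?ler_wpM2l// -exprS lerXn2r ?nnegrE ?addr_ge0// lerDl.
by ring.
Qed.

(** Differentiating term by term does not shrink the disc of convergence: at
    radius |y| the n-th term is at most d^-1 times the (n+1)-st term of the
    original absolute series at radius |y| + d. *)
Lemma is_cvg_pseries_diffs a r :
  (forall y, `|y| < r -> cvgn (pseries a y)) ->
  forall y, `|y| < r -> cvgn (pseries (pseries_diffs a) y).
Proof.
move=> ca y yr.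
(* a third of the gap, so that |y| < |y| + d < |y| + 2d < r *)
pose d := (r - `|y|) / 3.
have d0 : 0 < d by rewrite /d; lra.
have y0 := normr_ge0 y.
apply: normed_cvg.
pose z := `|y| + d; pose z' := `|y| + d + d.
have z0 : 0 <= z by rewrite /z; lra.
have z'0 : 0 <= z' by rewrite /z'; lra.
have cz : cvgn (pseries (fun i => `|a i|) z).
  apply: (@is_cvg_pseries_inside_norm _ a z'); last first.
    by rewrite !ger0_norm// /z /z'; lra.
  by apply: ca; rewrite ger0_norm// /z' /d; lra.
pose w n := `|a n| * z ^+ n.
have cw : cvgn (series (fun n => w n.+1)).
  have -> : series (fun n => w n.+1) = (fun n => series w n.+1 - w 0%N).
    by apply/funext => n; rewrite /series /= [in RHS]big_nat_recl// addrC addKr.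
  apply: is_cvgB; last exact: is_cvg_cst.
  move: cz => /cvg_ex[l cl]; apply/cvg_ex; exists l.
  by rewrite (cvg_shiftS (series w)).
have : cvgn (series (fun n => d^-1 * w n.+1)) := is_cvg_seriesZ (k := d^-1) cw.
apply: series_le_cvg => n /=; first exact: normr_ge0.
  by rewrite mulr_ge0 ?invr_ge0 ?(ltW d0)// mulr_ge0// exprn_ge0.
rewrite /w /pseries_diffs !normrM normrX (ger0_norm (ler0n _ _)).
rewrite ler_pdivlMl// mulrC -!mulrA mulrCA [X in _ * X <= _]mulrA.
by rewrite ler_wpM2l// natmul_exp_le// ltW.
Qed.

Definition psum a (x : R) : R := limn (pseries a x).

Lemma is_derive_psum a r :
  (forall y, `|y| < r -> cvgn (pseries a y)) ->
  forall y : R, `|y| < r -> is_derive y 1 (psum a) (psum (pseries_diffs a) y).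
Proof.
move=> ca y yr; have ca' := is_cvg_pseries_diffs ca.
have ca'' := is_cvg_pseries_diffs ca'.
have y0 := normr_ge0 y.
have Kr : `|(`|y| + r) / 2| < r by rewrite ger0_norm; lra.
apply: (pseries_snd_diffs (ca _ Kr) (ca' _ Kr) (ca'' _ Kr)).
by rewrite [X in _ < X]ger0_norm; lra.
Qed.

Lemma derivable_derive1n_psum (x0 r : R) (f : R -> R) a :
  (forall y, `|y| < r -> cvgn (pseries a y)) ->
  (forall x, `|x - x0| < r -> f x = psum a (x - x0)) ->
  forall j x, `|x - x0| < r -> derivable (derive1n j f) x 1.
Proof.
have df g b : (forall y, `|y| < r -> cvgn (pseries b y)) ->
    (forall x, `|x - x0| < r -> g x = psum b (x - x0)) ->
    forall y : R, `|y - x0| < r ->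
    is_derive y 1 g (psum (pseries_diffs b) (y - x0)).
  move=> cb gb y yr.
  apply: (@near_eq_is_derive _ _ _ (psum b \o (fun t => t - x0))).
    have : nbhs y (ball x0 r).
      apply: open_nbhs_nbhs; split; first exact: ball_open.
      by rewrite /ball/= distrC.
    by apply: filterS => z; rewrite /ball/= distrC => /gb.
  rewrite -[X in is_derive _ _ _ X]mulr1.
  apply: is_derive1_comp; first exact: is_derive_psum yr.
  by rewrite -[X in is_derive _ _ _ X]subr0; exact: is_deriveB.
move=> ca fa j; elim: j f a ca fa => [|j IH] f a ca fa x xr.
  by have [] := df f a ca fa x xr.
rewrite derive1Sn; apply: (IH _ (pseries_diffs a)) => //.
  exact: is_cvg_pseries_diffs.
by move=> y yr; have [_] := df f a ca fa y yr; rewrite derive1E.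
Qed.

End PowerSeries.

(** The radius does not depend on the order of differentiation, so that
    derivatives of all orders can be compared on one open ball. *)
Definition smooth_near {R : realType} (f : R -> R) (x0 : R) :=
  exists2 r : R, 0 < r &
    forall j x, `|x - x0| < r -> derivable (derive1n j f) x 1.

Lemma analytic_smooth_near {R : realType} (u : R -> R) (A : set R) :
  analytic_on u A -> forall x0, A x0 -> smooth_near u x0.
Proof.
move=> uA x0 /uA[a [r [r0 ua]]]; exists r => //.
have cvg_a y : `|y| < r -> pseries a y @ \oo --> u (x0 + y).
  by move=> yr; have := ua (x0 + y); rewrite addrAC subrr add0r; exact.
apply: (@derivable_derive1n_psum _ x0 r u a) => [y /cvg_a /cvgP//|x xr].
by apply/esym/cvg_lim => //; exact: ua.
Qed.

Lemma smooth_near_subr_horner {R : realType} (u : R -> R) (p : {poly R})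
    (x0 : R) : smooth_near u x0 ->
  smooth_near (fun t => u t - p.[t]) x0 /\
  (forall j, derive1n j (fun t => u t - p.[t]) x0 =
     derive1n j u x0 - (p^`(j)).[x0]).
Proof.
move=> [r r0 du].
have oB : open (ball x0 r) by exact: ball_open.
have dB j (y : R) : ball x0 r y -> derivable (derive1n j u) y 1.
  by rewrite /ball/= distrC; exact: du.
have E j : {in (ball x0 r : set R), derive1n j (fun t => u t - p.[t]) =1
    (fun t => derive1n j u t - p^`(j).[t])}.
  move=> y yB; rewrite (derive1nB_open (f := u) (g := horner p) (n := j) oB)//.
  - by rewrite derive1n_horner.
  - by move=> i z _; exact: dB.
  - by move=> i z _ _; rewrite derive1n_horner; exact: derivable_horner.
split; last by move=> j; rewrite E// inE; exact: ballxx.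
exists r => // j x xr.
apply: (@derivable_upto_eq_open _ j.+1 (fun t => u t - p.[t]) _ _ oB) => //.
move=> i z _ zB.
apply: (@near_eq_derivable _ _ _ (fun t => derive1n i u t - p^`(i).[t])).
  have : nbhs z (ball x0 r) by apply: open_nbhs_nbhs; split.
  by apply: filterS => y Ay; rewrite E ?inE.
apply: derivableB; [exact: dB|exact: derivable_horner].
by rewrite /ball/= distrC.
Qed.

(** * Extension by zero outside an interval *)

Section ZeroExtension.
Context {R : realType}.
Variables (a b : R).
Hypothesis ab : a <= b.
Implicit Types F G : R -> R.

Lemma derivable_itv_within F :
  (forall t, a <= t <= b -> derivable F t 1) ->
  {within `[a, b], continuous F}.
Proof.
by move=> dF; apply: derivable_within_continuous => t; rewrite in_itv; exact: dF.
Qed.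

Lemma derivable_itv_bounded F : (forall t, a <= t <= b -> derivable F t 1) ->
  exists B, forall t, a <= t <= b -> `|F t| <= B.
Proof.
move=> dF; have cF := derivable_itv_within dF.
have cnF : {within `[a, b], continuous (fun t => `|F t|)}.
  by move=> t; apply: cvg_norm; exact: cF.
have [c _ Fc] := EVT_max ab cnF.
by exists `|F c| => t tab; apply: Fc; rewrite in_itv.
Qed.

Lemma measurable_zero_ext F : (forall t, a <= t <= b -> derivable F t 1) ->
  measurable_fun [set: R] (F \_ `[a, b]).
Proof.
move=> dF; apply/(measurable_restrictT _ _).1 => //.
by apply: subspace_continuous_measurable_fun => //; exact: derivable_itv_within.
Qed.

Lemma zero_extE F t : (F \_ `[a, b]) t = if a <= t <= b then F t else 0.
Proof.
rewrite /patch; case: ifPn => [|/negP]; rewrite inE/= in_itv/=.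
  by move=> ->.
by move=> /negP/negbTE ->.
Qed.

Lemma zero_ext_bounded F B : (forall t, a <= t <= b -> `|F t| <= B) ->
  forall t, `|(F \_ `[a, b]) t| <= B.
Proof.
move=> FB t; rewrite zero_extE; case: ifPn => [|_]; first exact: FB.
by rewrite normr0 (le_trans (normr_ge0 (F a)))// FB// lexx.
Qed.

(** As F vanishes at both end points, its extension by zero is F composed with
    the projection of the line on [a, b], which does not increase distances. *)
Lemma lipschitz_zero_ext F G L :
  (forall t, a <= t <= b -> is_derive t 1 F (G t)) ->
  (forall t, a <= t <= b -> `|G t| <= L) -> F a = 0 -> F b = 0 ->
  lipschitz_const L (F \_ `[a, b]).
Proof.
move=> FG GL Fa Fb.
have L0 : 0 <= L by rewrite (le_trans (normr_ge0 (G a)))// GL// lexx.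
(* the projection on [a, b] *)
pose c x := Num.max a (Num.min b x).
have ce x : (F \_ `[a, b]) x = F (c x).
  rewrite zero_extE /c; have [ax|xa] /= := leP a x; last first.
    by rewrite min_r ?(le_trans (ltW xa))// max_l ?Fa// ltW.
  have [xb|bx] /= := leP x b; first by rewrite max_r.
  by rewrite max_r ?Fb.
have cab x : a <= c x <= b.
  by rewrite /c le_max lexx/= ge_max ab/= ge_min lexx.
suff H x y : x <= y -> `|(F \_ `[a, b]) x - (F \_ `[a, b]) y| <= L * `|x - y|.
  move=> x y; have [|/ltW] := leP x y; first exact: H.
  by rewrite distrC [X in _ <= _ * X]distrC; exact: H.
move=> xy; rewrite !ce distrC [X in _ <= _ * X]distrC.
have cxy : c x <= c y.
  rewrite /c; case: (leP a (Num.min b x)); case: (leP b x);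
    by case: (leP a (Num.min b y)); case: (leP b y); lra.
have FG' t : t \in `](c x), (c y)[%R -> is_derive t 1 F (G t).
  rewrite in_itv/= => /andP[xt ty]; apply: FG.
  by have /andP[] := cab x; have /andP[] := cab y; lra.
have cF : {within `[c x, c y], continuous F}.
  apply: derivable_within_continuous => t; rewrite in_itv/= => /andP[xt ty].
  have [] // := FG t _.
  by have /andP[] := cab x; have /andP[] := cab y; lra.
have [t + ->] := MVT_segment cxy FG' cF.
rewrite in_itv/= => /andP[xt ty]; rewrite normrM.
apply: ler_pM => //.
  by apply: GL; have /andP[] := cab x; have /andP[] := cab y; lra.
rewrite !ger0_norm ?subr_ge0//.
rewrite /c; case: (leP a (Num.min b x)); case: (leP b x);
    by case: (leP a (Num.min b y)); case: (leP b y); lra.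
Qed.

Lemma is_derive_zero_ext F G :
  (forall t, a <= t <= b -> is_derive t 1 F (G t)) ->
  forall t, ~ [set a; b] t ->
  is_derive t 1 (F \_ `[a, b]) ((G \_ `[a, b]) t).
Proof.
move=> FG t tab.
have ta : t != a by apply/eqP => ta; apply: tab; left.
have tb : t != b by apply/eqP => tb; apply: tab; right.
rewrite zero_extE; case: ifPn => [|tn].
  move=> /andP[at_ tb_].
  apply: (near_eq_is_derive (f := F)); last by apply: FG; rewrite at_.
  have : nbhs t (`]a, b[%classic : set R).
    apply: open_nbhs_nbhs; split; first exact: interval_open.
    by rewrite /= in_itv/= !lt_neqAle eq_sym ta at_ tb.
  apply: filterS => s; rewrite /= in_itv/= zero_extE => /andP[/ltW -> /ltW ->].
  by [].
have d0 := @is_derive_cst R R R 0 t 1.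
apply: (near_eq_is_derive _ d0).
have : nbhs t (~` `[a, b]%classic : set R).
  apply: open_nbhs_nbhs; split.
    by apply: closed_openC; exact: interval_closed.
  by rewrite /= in_itv/=; exact/negP.
by apply: filterS => s; rewrite /= in_itv/= zero_extE => /negP/negbTE ->.
Qed.

End ZeroExtension.

Section IteratedConv.
Context {R : realType}.
Variables (a b : R) (k : nat) (e w : R -> R).
Hypotheses (ab : a <= b) (se : forall t, a <= t <= b -> smooth_near e t).
Hypothesis e0 : forall j, (j <= k)%N ->
  derive1n j e a = 0 /\ derive1n j e b = 0.
Hypothesis iw : lebesgue_measure.-integrable setT (EFin \o w).

Lemma smooth_near_is_derive j t : a <= t <= b ->
  is_derive t 1 (derive1n j e) (derive1n j.+1 e t).
Proof.
move=> /se[r r0 de]; apply: DeriveDef.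
  by apply: de; rewrite subrr normr0.
by rewrite derive1nS derive1E.
Qed.

(** The bound on the next derivative serves as Lipschitz constant.  The
    vanishing hypothesis stops at order k, hence the last derivative that can be
    moved on the first factor is the one of order k + 1. *)
Lemma is_derive_convolution_zero_ext j (x : R) : (j <= k)%N ->
  is_derive x 1 (convolution (derive1n j e \_ `[a, b]) w)
    (convolution (derive1n j.+1 e \_ `[a, b]) w x).
Proof.
move=> jk; have dj i t : a <= t <= b -> derivable (derive1n i e) t 1.
  by move=> /(smooth_near_is_derive i)[].
have [L eL] := derivable_itv_bounded ab (dj j.+1).
have [B eB] := derivable_itv_bounded ab (dj j).
have [ea eb] := e0 jk.
apply: (@is_derive_convolution _ L B [set a; b]) => //.
- exact: lipschitz_zero_ext (smooth_near_is_derive j) eL ea eb.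
- exact: zero_ext_bounded.
- exact: measurable_zero_ext (dj _).
- apply/negligibleP; first by apply: measurableU.
  apply: countable_lebesgue_measure0; apply: finite_set_countable.
  exact: finite_set2.
- exact: is_derive_zero_ext (smooth_near_is_derive j).
Qed.

Lemma derive1n_convolution j : (j <= k.+1)%N ->
  derive1n j (convolution (e \_ `[a, b]) w) =
  convolution (derive1n j e \_ `[a, b]) w.
Proof.
elim: j => [//|j IH] jk; rewrite derive1nS IH ?(ltnW jk)//.
apply/funext => x; rewrite derive1E.
by have [_] := is_derive_convolution_zero_ext x jk.
Qed.

Lemma derivable_upto_convolution A :
  derivable_upto k.+1 (convolution (e \_ `[a, b]) w) A.
Proof.
move=> j x jk _; rewrite derive1n_convolution ?(ltnW jk)//.
by have [] := is_derive_convolution_zero_ext x jk.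
Qed.

End IteratedConv.

(** * The Abel kernel and the functional equation of Gamma *)

Section Powers.
Context {R : realType}.
Implicit Types g t : R.

Lemma powR_derivable_LR g (a b : R) : 0 < a -> a < b ->
  derivable_oo_LRcontinuous (fun t : R => t `^ g) a b.
Proof.
move=> a0 ab; have dt t : a <= t -> derivable (fun t : R => t `^ g) t 1.
  by move=> at_; apply: derivable_powR; rewrite in_itv/= andbT (lt_le_trans a0).
have ct t : a <= t -> {for t, continuous (fun t : R => t `^ g)}.
  by move=> /dt at_; apply: differentiable_continuous; exact/derivable1_diffP.
split.
- by move=> t; rewrite in_itv/= => /andP[/ltW /dt].
- by apply: cvg_at_right_filter; exact: ct.
- by apply: cvg_at_left_filter; apply: ct; exact: ltW.
Qed.

Lemma powR_continuous_within g (a b : R) : 0 < a ->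
  {within `[a, b], continuous (fun t : R => t `^ g)}.
Proof.
move=> a0; apply: derivable_within_continuous => t.
rewrite in_itv/= => /andP[at_ _].
by apply: derivable_powR; rewrite in_itv/= andbT (lt_le_trans a0).
Qed.

(** The graph of the concave function t^g lies below its tangent at t = 1.
    With x = ln t this is the weighted inequality
    e^(g x) <= g e^x + (1 - g), which follows from e^y >= 1 + y at
    y = (1 - g) x and at y = - g x. *)
Lemma powR_le_tangent g t : 0 < g < 1 -> 0 <= t -> t `^ g <= 1 + g * (t - 1).
Proof.
move=> /andP[g0 g1]; rewrite le_eqVlt => /predU1P[<-|t0].
  by rewrite powR0 ?gt_eqF//; lra.
rewrite /powR gt_eqF//; set x := ln t.
have -> : t = expR x by rewrite lnK ?posrE.
have gx0 := expR_gt0 (g * x).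
have -> : expR x = expR (g * x) * expR (x - g * x).
  by rewrite -expRD; congr expR; ring.
have h1 := expR_ge1Dx (x - g * x); have h2 := expR_ge1Dx (- (g * x)).
have e1 : expR (g * x) * expR (- (g * x)) = 1 by rewrite -expRD subrr expR0.
move: gx0 h1 h2 e1; move: (expR (g * x)) (expR (x - g * x)) (expR (- (g * x))).
move=> A B C A0 BB CC AC.
suff : 1 <= g * B + (1 - g) * C.
  move=> /(ler_wpM2l (ltW A0)).
  by rewrite mulr1 mulrDr mulrCA [A * (_ * C)]mulrCA AC; lra.
have := ler_wpM2l (ltW g0) BB; have g1' : 0 <= 1 - g by lra.
by have := ler_wpM2l g1' CC; lra.
Qed.

Lemma powR_two_point_le g t : 0 < g < 1 -> -1 <= t <= 1 ->
  (1 + t) `^ g + (1 - t) `^ g <= 2.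
Proof.
move=> g01 t11.
have h1 : (1 + t) `^ g <= 1 + g * (1 + t - 1).
  by apply: powR_le_tangent => //; lra.
have h2 : (1 - t) `^ g <= 1 + g * (1 - t - 1).
  by apply: powR_le_tangent => //; lra.
lra.
Qed.

End Powers.
Section AbelKernel.
Context {R : realType}.
Implicit Types (g b s : R).
Local Notation mu := (@lebesgue_measure R).

(** The weight s^(g-1) of the Riemann-Liouville integrals.  For g < 1 it
    vanishes at s = 0, because 0 `^ (1 - g) = 0 and 0^-1 = 0. *)
Definition abel_kernel g s : R := (s `^ (1 - g))^-1.

Lemma abel_kernel_ge0 g s : 0 <= abel_kernel g s.
Proof. by rewrite invr_ge0 powR_ge0. Qed.

Lemma abel_kernelE g s : abel_kernel g s = s `^ (g - 1).
Proof. by rewrite /abel_kernel -powRN opprB. Qed.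

Lemma measurable_abel_kernel g : measurable_fun [set: R] (abel_kernel g).
Proof.
rewrite (_ : abel_kernel g = fun s => s `^ (g - 1)).
  exact: measurable_powR.
by apply/funext => s; rewrite abel_kernelE.
Qed.

Lemma integral_abel_kernel_itv g (a b : R) : 0 < g -> 0 < a -> a < b ->
  (\int[mu]_(s in `[a, b]) (abel_kernel g s)%:E =
   (b `^ g / g)%:E - (a `^ g / g)%:E)%E.
Proof.
move=> g0 a0 ab.
rewrite (_ : abel_kernel g = fun s => s `^ (g - 1)); last first.
  by apply/funext => s; rewrite abel_kernelE.
pose F (t : R) := t `^ g / g.
have [dF Fa Fb] := powR_derivable_LR g a0 ab.
apply: (@continuous_FTC2 R _ F) => //.
- exact: powR_continuous_within.
- split.
  + by move=> t tab; apply: derivableM; [exact: dF|exact: derivable_cst].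
  + by apply: cvgM => //; exact: cvg_cst.
  + by apply: cvgM => //; exact: cvg_cst.
- move=> t; rewrite in_itv/= => /andP[at_ _]; have t0 := lt_trans a0 at_.
  have := is_deriveM (is_derive1_powR g t0) (is_derive_cst (g^-1 : R) t 1).
  rewrite derive1E => -[_ ->].
  rewrite scaler0 add0r [_ *: _]/GRing.scale/= mulrA mulVf ?mul1r//.
  by rewrite gt_eqF.
Qed.

(** The primitive s^g / g has no derivative at 0, so the fundamental theorem is
    applied on [a_n, b] with a_n decreasing to 0, and monotone convergence gives
    the integral up to the singularity. *)
Lemma integral_abel_kernel g b : 0 < g < 1 -> 0 <= b ->
  (\int[mu]_(s in `[0%R, b]) (abel_kernel g s)%:E = (b `^ g / g)%:E)%E.
Proof.
move=> /andP[g0 g1]; rewrite le_eqVlt => /predU1P[<-|b0].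
  by rewrite set_itv1 integral_set1 powR0 ?gt_eqF// mul0r.
have mk (D : set R) : measurable_fun D (fun s => (abel_kernel g s)%:E).
  apply/measurable_EFinP; apply: measurable_funTS.
  exact: measurable_abel_kernel.
pose a (n : nat) : R := b / n.+2%:R.
have a0 n : 0 < a n by rewrite divr_gt0.
have ab n : a n < b by rewrite ltr_pdivrMr// ltr_pMr// ltr1n.
have acvg : a n @[n --> \oo] --> 0.
  rewrite -(mulr0 b); apply: cvgM; first exact: cvg_cst.
  by rewrite (cvg_shiftS (@harmonic R)); exact: cvg_harmonic.
rewrite -integral_itv_obnd_cbnd//.
pose F n : set R := `[a n, b]%classic.
have -> : (`]0%R, b%R]%classic : set R) = \bigcup_n F n.
  apply/seteqP; split => s /=.
    rewrite in_itv/= => /andP[s0 sb].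
    have : \forall n \near \oo, a n < s by apply: cvgr_lt acvg _ s0.
    move=> [n _ /(_ n (leqnn n)) ans]; exists n => //.
    by rewrite /F/= in_itv/= (ltW ans).
  move=> [n _]; rewrite /F/= !in_itv/= => /andP[ans ->].
  by rewrite (lt_le_trans (a0 n)).
have cvg_int : (\int[mu]_(s in F n) (abel_kernel g s)%:E)%E @[n --> \oo] -->
    (\int[mu]_(s in \bigcup_n F n) (abel_kernel g s)%:E)%E.
  apply: (@ge0_nondecreasing_set_cvg_integral _ (measurableTypeR R) R F _ mu) => //.
  - move=> n m nm; apply/subsetPset => s.
    rewrite /F/= !in_itv/= => /andP[ans ->].
    by rewrite andbT (le_trans _ ans)// ler_pM2l// lef_pV2 ?posrE// ler_nat.
  - by move=> n; exact: measurable_itv.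
  - by move=> n; exact: mk.
  - by move=> n s _; rewrite lee_fin abel_kernel_ge0.
rewrite -(cvg_lim _ cvg_int)//; apply/cvg_lim => //.
rewrite (_ : (fun n => _) =
  (fun n => (b `^ g / g - (a n) `^ g / g)%:E)); last first.
  by apply/funext => n; rewrite /F integral_abel_kernel_itv// EFinB.
apply: cvg_EFin; first exact: nearW.
rewrite -[X in _ --> X]subr0; apply: cvgB; first exact: cvg_cst.
rewrite -(mul0r g^-1); apply: cvgM; last exact: cvg_cst.
have /cvg_at_rightP := @powR_cvg0 R g g0; apply; split => //.
Qed.

End AbelKernel.

Section GammaFunctional.
Context {R : realType}.
Local Notation mu := (@lebesgue_measure R).

Lemma Gamma_ge0 (z : R) : 0 <= Gamma z.
Proof.
by apply: Rintegral_ge0 => t _; rewrite mulr_ge0 ?powR_ge0 ?expR_ge0.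
Qed.

(** The boundary term at infinity: t^g <= t for t >= 1, and e^t >= 1 + t^2 / 2
    bounds t e^(-t) by 2 / t. *)
Lemma powR_expRN_cvg0 (g : R) : 0 < g < 1 ->
  (n.+2%:R : R) `^ g * expR (- n.+2%:R) @[n --> \oo] --> 0.
Proof.
move=> /andP[g0 g1].
apply: (@squeeze_cvgr _ _ _ _ (cst 0) (fun n => 2 * harmonic n.+1)).
- apply: nearW => n; rewrite mulr_ge0 ?powR_ge0 ?expR_ge0//=.
  set b : R := n.+2%:R; have b0 : 0 < b by rewrite ltr0n.
  have b1 : 1 <= b by rewrite ler1n.
  rewrite expRN ler_pdivrMr ?expR_gt0//.
  apply: (le_trans (ler1_powR b1 (ltW g1))).
  have := expR_ge1Dxn 1 (ltW b0); rewrite (_ : 2`!%:R = 2)// => hb.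
  have : (2 * b^-1) * (1 + b ^+ 2 / 2) <= 2 * b^-1 * expR b.
    by rewrite ler_wpM2l// mulr_ge0// invr_ge0 ltW.
  apply: le_trans; have -> : 2 * b^-1 * (1 + b ^+ 2 / 2) = 2 * b^-1 + b.
    by field; rewrite gt_eqF.
  by rewrite lerDr mulr_ge0// invr_ge0 ltW.
- exact: cvg_cst.
- rewrite -(mulr0 2); apply: cvgM; first exact: cvg_cst.
  by rewrite (cvg_shiftS (@harmonic R)); exact: cvg_harmonic.
Qed.

Lemma continuous_expRN : continuous (fun t : R => expR (- t)).
Proof.
move=> t; apply: (continuous_comp (f := -%R) (g := expR)).
  exact: opp_continuous.
exact: continuous_expR.
Qed.

Lemma integral_Gamma_itv (g a b : R) : 0 < g -> 0 < a -> a < b ->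
  (\int[mu]_(t in `[a, b]) (t `^ g * expR (- t))%:E =
   (a `^ g * expR (- a) - b `^ g * expR (- b))%:E +
   g%:E * \int[mu]_(t in `[a, b]) (t `^ (g - 1) * expR (- t))%:E)%E.
Proof.
move=> g0 a0 ab; pose F (t : R) := t `^ g; pose G (t : R) := - expR (- t).
have dG (t : R) : is_derive t 1 G (expR (- t)).
  rewrite -[X in is_derive _ _ _ X]opprK; apply: is_deriveN.
  rewrite -[X in is_derive _ _ _ X]mulrN1.
  exact: (@is_derive1_comp _ expR -%R).
have cG t : {for t, continuous G}.
  by apply: differentiable_continuous; apply/derivable1_diffP; have [] := dG t.
have -> := (@integration_by_parts R F G (fun t => g * t `^ (g - 1))
  (fun t => expR (- t)) a b ab).
- rewrite /F /G; set A := (\int[mu]_(t in _) _)%E.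
  have -> : A = (- (g%:E *
      \int[mu]_(t in `[a, b]) (t `^ (g - 1) * expR (- t))%:E))%E.
    rewrite -ge0_integralZl_EFin//; last 3 first.
    - by move=> t _; rewrite lee_fin mulr_ge0 ?powR_ge0 ?expR_ge0.
    - apply/measurable_EFinP; apply: measurable_funTS.
      apply: measurable_funM; first exact: measurable_powR.
      exact: continuous_measurable_fun continuous_expRN.
    - exact: ltW.
    rewrite -integral_ge0N; last first.
      by move=> t _; rewrite -EFinM lee_fin !mulr_ge0 ?powR_ge0 ?expR_ge0// ltW.
    by apply: eq_integral => t _; rewrite -EFinM -EFinN mulrN mulrA.
  rewrite oppeK; congr (_%:E + _)%E; ring.
- move=> t; apply: cvgM; first exact: cvg_cst.
  exact: powR_continuous_within.
- exact: powR_derivable_LR.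
- move=> t; rewrite in_itv/= => /andP[at_ _].
  by apply: powR_derive1; rewrite in_itv/= andbT (lt_trans a0).
- apply: continuous_subspaceT; exact: continuous_expRN.
- split; first by move=> t _; have [] := dG t.
  + by apply: cvg_at_right_filter; exact: cG.
  + by apply: cvg_at_left_filter; exact: cG.
- by move=> t _; rewrite derive1E; have [_] := dG t.
Qed.

(** Integration by parts on [1 / (n + 2), n + 2], then monotone convergence on both sides.
    The limit identity holds between extended nonnegative numbers, so
    integrability of the Gamma integrand is never established: were the integral
    infinite, both sides would be 0 after truncation to real numbers. *)
Lemma GammaD1 (g : R) : 0 < g < 1 -> Gamma (g + 1) = g * Gamma g.
Proof.
move=> g01; have /andP[g0 g1] := g01.
pose I (p : R) : \bar R :=
  (\int[mu]_(t in `]0%R, +oo[) (t `^ p * expR (- t))%:E)%E.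
suff H : I g = (g%:E * I (g - 1)%R)%E.
  rewrite /Gamma addrK /Rintegral -/(I g) -/(I (g - 1)) H.
  case: (I (g - 1)) => [r| |]; first by [].
  - by rewrite gt0_muley ?lte_fin//= mulr0.
  - by rewrite gt0_muleNy ?lte_fin//= mulr0.
pose a (n : nat) : R := n.+2%:R^-1; pose b (n : nat) : R := n.+2%:R.
pose F n : set R := `[a n, b n]%classic.
have a0 n : 0 < a n by rewrite invr_gt0.
have ab n : a n < b n.
  by rewrite (@lt_trans _ _ 1)// ?invf_lt1// ltr1n.
have acvg : a n @[n --> \oo] --> 0.
  by rewrite (cvg_shiftS (@harmonic R)); exact: cvg_harmonic.
have cvgI p :
    (\int[mu]_(t in F n) (t `^ p * expR (- t))%:E)%E @[n --> \oo] --> I p.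
  rewrite /I; have -> : (`]0%R, +oo[%classic : set R) = \bigcup_n F n.
    apply/seteqP; split => s /=.
      rewrite in_itv/= andbT => s0.
      have : \forall n \near \oo, a n < s by apply: cvgr_lt acvg _ s0.
      move=> [n _ an]; have [m sm] : exists m : nat, s < m%:R.
        by exists (Num.bound s); apply: archi_boundP; exact: ltW.
      exists (maxn n m) => //; rewrite /F/= in_itv/=; apply/andP; split.
        by apply/ltW/an; exact: leq_maxl.
      rewrite (le_trans (ltW sm))// ler_nat (leq_trans (leq_maxr n m))//.
      by rewrite -addn2 leq_addr.
    move=> [n _]; rewrite /F/= !in_itv/= andbT => /andP[ans _].
    by rewrite (lt_le_trans (a0 n)).
  apply: (@ge0_nondecreasing_set_cvg_integral _ (measurableTypeR R) R F _ mu) => //.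
  - move=> n m nm; apply/subsetPset => s.
    rewrite /F/= !in_itv/= => /andP[ans sb].
    rewrite (le_trans _ ans) ?lef_pV2 ?posrE ?ler_nat//=.
    by rewrite (le_trans sb)// ler_nat.
  - by move=> n; exact: measurable_itv.
  - move=> n; apply/measurable_EFinP; apply: measurable_funTS.
    apply: measurable_funM; first exact: measurable_powR.
    by apply: measurableT_comp => //; exact: measurable_expR.
  - by move=> n t _; rewrite lee_fin mulr_ge0 ?powR_ge0 ?expR_ge0.
rewrite -(cvg_lim _ (cvgI g))//; apply/cvg_lim => //.
rewrite (_ : (fun n => _) = (fun n =>
    (a n `^ g * expR (- a n) - b n `^ g * expR (- b n))%:E +
    g%:E * \int[mu]_(t in F n) (t `^ (g - 1) * expR (- t))%:E)%E); last first.
  by apply/funext => n; rewrite /F integral_Gamma_itv.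
rewrite -[X in _ --> X]add0e; apply: cvgeD.
- by [].
- apply: cvg_EFin; first exact: nearW.
  rewrite -[X in _ --> X](subrr 0); apply: cvgB; last exact: powR_expRN_cvg0.
  rewrite -[X in _ --> X](mul0r 1); apply: cvgM.
    by have /cvg_at_rightP := @powR_cvg0 R g g0; apply; split.
  have := cvg_comp _ _ acvg (@continuous_expRN 0).
  by rewrite oppr0 expR0; apply: cvg_trans.
- by apply: cvgeZl => //.
Qed.

End GammaFunctional.

(** * Riesz potentials as convolutions *)

Section RieszKernel.
Context {R : realType}.
Implicit Types (g x s : R) (f : R -> R).
Local Notation mu := (@lebesgue_measure R).

Lemma convolution_swap f w x : measurable_fun [set: R] f ->
  measurable_fun [set: R] w ->
  convolution f w x = Rintegral mu setT (fun t => f t * w (x - t)).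
Proof.
move=> mf mw; rewrite /convolution /Rintegral; congr fine.
rewrite -[RHS](integral_reflection x).
  by apply: eq_integral => s _; rewrite opprB addrCA subrr addr0.
apply/measurable_EFinP; apply: measurable_funM => //.
exact: measurableT_comp mw (measurable_reflection x).
Qed.

Lemma measurable_compN f : measurable_fun [set: R] f ->
  measurable_fun [set: R] (fun s => f (- s)).
Proof.
move=> mf; rewrite (_ : (fun s => _) = f \o (fun s => 0 - s)).
  exact: measurableT_comp mf (measurable_reflection 0).
by apply/funext => s /=; rewrite sub0r.
Qed.

(** For x and t in [-1, 1] the difference x - t lies in [-2, 2], so cutting at 2
    loses nothing and makes the kernel integrable on the line. *)
Definition cut_abel_kernel g : R -> R := abel_kernel g \_ `[0, 2].

Lemma measurable_zero_ext_abel g (b : R) :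
  measurable_fun [set: R] (abel_kernel g \_ `[0, b]).
Proof.
apply/(measurable_restrictT _ _).1 => //.
by apply: measurable_funTS; exact: measurable_abel_kernel.
Qed.

Lemma zero_ext_abel_ge0 g b s : 0 <= (abel_kernel g \_ `[0, b]) s.
Proof. by rewrite zero_extE; case: ifP => // _; exact: abel_kernel_ge0. Qed.

Lemma integral_zero_ext_abel g b : 0 < g < 1 -> 0 <= b ->
  (\int[mu]_s ((abel_kernel g \_ `[0%R, b]) s)%:E = (b `^ g / g)%:E)%E.
Proof.
move=> g01 b0; rewrite -integral_abel_kernel// [RHS]integral_mkcond.
by apply: eq_integral => s _; rewrite restrict_EFin.
Qed.

Lemma integral_zero_ext_abelN g b : 0 < g < 1 -> 0 <= b ->
  (\int[mu]_s ((abel_kernel g \_ `[0%R, b]) (- s)%R)%:E = (b `^ g / g)%:E)%E.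
Proof.
move=> g01 b0; rewrite -integral_zero_ext_abel// -[RHS](integral_reflection 0).
  by apply: eq_integral => s _; rewrite sub0r.
by apply/measurable_EFinP; exact: measurable_zero_ext_abel.
Qed.

Lemma integrable_cut_abel_kernel g : 0 < g < 1 ->
  mu.-integrable setT (EFin \o cut_abel_kernel g).
Proof.
move=> g01; apply/integrableP; split.
  by apply/measurable_EFinP; exact: measurable_zero_ext_abel.
apply: (@le_lt_trans _ _ (2 `^ g / g)%:E); last exact: ltry.
rewrite -integral_zero_ext_abel// le_eqVlt; apply/orP; left; apply/eqP.
by apply: eq_integral => s _ /=; rewrite ger0_norm// zero_ext_abel_ge0.
Qed.

Lemma integrable_cut_abel_kernelN g : 0 < g < 1 ->
  mu.-integrable setT (EFin \o (fun s => cut_abel_kernel g (- s))).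
Proof.
move=> /integrable_cut_abel_kernel /(integrable_reflection 0).
by apply: eq_integrable => // s _ /=; rewrite sub0r.
Qed.

(** For -1 < x < 1, a point t lies in [-1, x] exactly when t is in [-1, 1] and
    x - t is in [0, 2]. *)
Lemma RL_left_convolution g f x : -1 < x < 1 ->
  measurable_fun [set: R] (f \_ `[-1, 1]) ->
  RL_left g f x = (Gamma g)^-1 *
    convolution (f \_ `[-1, 1]) (cut_abel_kernel g) x.
Proof.
move=> x11 mf; rewrite /RL_left convolution_swap//; last first.
  exact: measurable_zero_ext_abel.
congr (_ * _); rewrite Rintegral_mkcond; apply: eq_Rintegral => t _.
rewrite /cut_abel_kernel !zero_extE /abel_kernel.
case: ifPn => [/andP[t1 tx]|tx]; first by rewrite !ifT//; lra.
case: ifPn => [/andP[t1 t2]|]; last by rewrite mul0r.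
by rewrite ifF ?mulr0//; apply: contraNF tx => /andP[]; lra.
Qed.

Lemma RL_right_convolution g f x : -1 < x < 1 ->
  measurable_fun [set: R] (f \_ `[-1, 1]) ->
  RL_right g f x = (Gamma g)^-1 *
    convolution (f \_ `[-1, 1]) (fun s => cut_abel_kernel g (- s)) x.
Proof.
move=> x11 mf; rewrite /RL_right convolution_swap//; last first.
  exact: measurable_compN (measurable_zero_ext_abel g 2).
congr (_ * _); rewrite Rintegral_mkcond; apply: eq_Rintegral => t _.
rewrite /cut_abel_kernel !zero_extE /abel_kernel opprB.
case: ifPn => [/andP[t1 tx]|tx]; first by rewrite !ifT//; lra.
case: ifPn => [/andP[t1 t2]|]; last by rewrite mul0r.
by rewrite ifF ?mulr0//; apply: contraNF tx => /andP[]; lra.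
Qed.

Definition riesz_const (k : nat) g : R :=
  if odd k.+1 then riesz_c1 g else riesz_c2 g.

(** The two one-sided kernels enter with opposite signs when k + 1 is odd and with
    equal signs when k + 1 is even, as in the two Riesz potentials. *)
Definition riesz_kernel (k : nat) g : R -> R := fun s =>
  riesz_const k g / Gamma g *
  (cut_abel_kernel g s + (-1) ^+ k.+1 * cut_abel_kernel g (- s)).

Lemma integrable_riesz_kernel k g : 0 < g < 1 ->
  mu.-integrable setT (EFin \o riesz_kernel k g).
Proof.
move=> g01.
have iN := integrableZl measurableT ((-1) ^+ k.+1)
  (integrable_cut_abel_kernelN g01).
have iD := integrableD measurableT (integrable_cut_abel_kernel g01) iN.
exact: (integrableZl measurableT (riesz_const k g / Gamma g) iD).
Qed.

Lemma riesz_potential_convolution k (alpha x B : R) f : -1 < x < 1 ->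
  0 < k.+1%:R - alpha < 1 -> measurable_fun [set: R] (f \_ `[-1, 1]) ->
  (forall t, `|(f \_ `[-1, 1]) t| <= B) ->
  riesz_potential k alpha f x =
  convolution (f \_ `[-1, 1]) (riesz_kernel k (k.+1%:R - alpha)) x.
Proof.
set g := _ - alpha => x11 g01 mf fB.
set h := f \_ _ in mf fB *.
pose kl := cut_abel_kernel g; pose kr s := kl (- s).
have il : mu.-integrable setT (EFin \o (fun s => h (x - s) * kl s)).
  by apply: integrable_convolution mf fB _; exact: integrable_cut_abel_kernel.
have ir : mu.-integrable setT (EFin \o (fun s => h (x - s) * kr s)).
  by apply: integrable_convolution mf fB _; exact: integrable_cut_abel_kernelN.
have -> : convolution h (riesz_kernel k g) x = riesz_const k g / Gamma g *
    (convolution h kl x + (-1) ^+ k.+1 * convolution h kr x).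
  have iZ := integrableZl measurableT ((-1) ^+ k.+1) ir.
  rewrite /convolution -RintegralZl// -RintegralD// -RintegralZl//; last first.
    exact: (integrableD measurableT il iZ).
  by apply: eq_Rintegral => s _; rewrite /riesz_kernel -/kl -/(kr _); ring.
rewrite /riesz_potential /riesz_const -signr_odd -/g.
case: (odd k.+1); rewrite ?expr1 ?expr0 /riesz_Io /riesz_Ie.
  by rewrite RL_left_convolution// RL_right_convolution// -/h -/kl; ring.
by rewrite RL_left_convolution// RL_right_convolution// -/h -/kl; ring.
Qed.

Lemma riesz_c1_gt0 g : 0 < g < 1 -> 0 < riesz_c1 g.
Proof.
move=> g01; have pi0 := pi_gt0 R.
rewrite invr_gt0 mulr_gt0// sin_gt0_pi//; apply/andP; split; nra.
Qed.

Lemma riesz_c2_gt0 g : 0 < g < 1 -> 0 < riesz_c2 g.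
Proof.
move=> g01; have pi0 := pi_gt0 R.
rewrite invr_gt0 mulr_gt0// cos_gt0_pihalf//; apply/andP; split; nra.
Qed.

(** The support of f keeps s within [x - 1, x + 1], so the two one-sided kernels
    contribute (1 + x)^g / g and (1 - x)^g / g, whose sum is at most 2 / g.  An
    almost everywhere bound on f suffices. *)
Lemma norm_convolution_riesz_kernel k g (M x : R) f : 0 < g < 1 ->
  -1 <= x <= 1 -> mu.-integrable setT
    (EFin \o (fun s => (f \_ `[-1, 1]) (x - s) * riesz_kernel k g s)) ->
  {ae mu, forall t, `|(f \_ `[-1, 1]) t| <= M} -> 0 <= M ->
  `|convolution (f \_ `[-1, 1]) (riesz_kernel k g) x| <=
  2 * riesz_const k g / Gamma (g + 1) * M.
Proof.
move=> g01 x11 iW fM M0.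
set h := f \_ _ in iW fM *; set W := riesz_kernel k g in iW *.
have /andP[g0 g1] := g01.
have c0 : 0 <= riesz_const k g.
  by rewrite /riesz_const; case: ifP; rewrite ltW ?riesz_c1_gt0 ?riesz_c2_gt0.
pose C := riesz_const k g / Gamma g.
have C0 : 0 <= C by rewrite mulr_ge0// invr_ge0 Gamma_ge0.
(* the parts of the two one-sided kernels that the support of f can reach *)
pose L := abel_kernel g \_ `[0, 1 + x]; pose Q := abel_kernel g \_ `[0, 1 - x].
have L0 s : 0 <= L s by exact: zero_ext_abel_ge0.
have Q0 s : 0 <= Q s by exact: zero_ext_abel_ge0.
have mL : measurable_fun [set: R] L by exact: measurable_zero_ext_abel.
have mQ : measurable_fun [set: R] (fun s => Q (- s)).
  exact: measurable_compN (measurable_zero_ext_abel g _).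
rewrite -lee_fin EFin_normr_Rintegral//.
apply: (le_trans (le_abse_integral mu measurableT (measurable_int _ iW))).
apply: (@le_trans _ _ (\int[mu]_s ((M * C) * (L s + Q (- s)%R))%:E)%E).
  apply: ae_ge0_le_integral => //.
  - by apply: measurableT_comp => //; exact: (measurable_int _ iW).
  - by move=> s _; rewrite lee_fin mulr_ge0 ?addr_ge0// mulr_ge0.
  - apply/measurable_EFinP; apply: measurable_funM => //.
    exact: measurable_funD.
  apply: ae_imp (ae_reflection x fM) => s hs _ /=.
  rewrite lee_fin normrM.
  have [xs|xs] := boolP (-1 <= x - s <= 1); last first.
    rewrite /h zero_extE ifF ?normr0 ?mul0r; last exact: negbTE.
    by rewrite mulr_ge0 ?addr_ge0// mulr_ge0.
  rewrite -mulrA ler_pM// normrM ger0_norm// ler_wpM2l//.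
  rewrite (le_trans (ler_normD _ _))// normrM normrX normrN1 expr1n mul1r.
  rewrite !ger0_norm ?zero_ext_abel_ge0// lerD//.
    rewrite /cut_abel_kernel /L !zero_extE; case: ifPn => [/andP[s0 s2]|_].
      by rewrite ifT//; lra.
    by case: ifP => // _; exact: abel_kernel_ge0.
  rewrite /cut_abel_kernel /Q !zero_extE; case: ifPn => [/andP[s0 s2]|_].
    by rewrite ifT//; lra.
  by case: ifP => // _; exact: abel_kernel_ge0.
under eq_integral do rewrite EFinM EFinD.
rewrite ge0_integralZl_EFin//; last 3 first.
- by move=> s _; rewrite adde_ge0 ?lee_fin.
- by apply: emeasurable_funD; apply/measurable_EFinP.
- exact: mulr_ge0.
rewrite ge0_integralD//; last 4 first.
- by move=> s _; rewrite lee_fin.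
- exact/measurable_EFinP.
- by move=> s _; rewrite lee_fin.
- exact/measurable_EFinP.
rewrite integral_zero_ext_abel//; last lra.
rewrite integral_zero_ext_abelN//; last lra.
rewrite -EFinD -EFinM lee_fin -mulrDl GammaD1// invfM.
have -> : 2 * riesz_const k g * (g^-1 * (Gamma g)^-1) * M =
  M * C * (2 / g) by rewrite /C; ring.
apply: ler_wpM2l; first exact: mulr_ge0.
apply: ler_wpM2r; first by rewrite invr_ge0 ltW.
exact: powR_two_point_le.
Qed.

End RieszKernel.

(** * Essential suprema on the interval *)

Section EssentialSupremum.
Context {R : realType}.
Implicit Types (f : R -> R).
Local Notation mu := (@lebesgue_measure R).

Lemma Linfty_normE f :
  Linfty_norm f = ess_sup mu (abse \o (EFin \o (f \_ `[-1, 1]))).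
Proof.
rewrite /Linfty_norm unlock.
suff -> : (0 < mu [set: R])%E by [].
apply: (@lt_le_trans _ _ (mu `[0, 1]%classic)).
  by rewrite lebesgue_measure_itv/= lte_fin ltr01 oppr0 adde0 lte_fin.
by apply: le_measure; rewrite ?inE//; exact: measurable_itv.
Qed.

Lemma Linfty_norm_ge f :
  {ae mu, forall t, (`|(f \_ `[-1, 1]) t|%:E <= Linfty_norm f)%E}.
Proof. by rewrite Linfty_normE; exact: ess_sup_ge. Qed.

Lemma Linfty_norm_fin f B : (forall t, `|(f \_ `[-1, 1]) t| <= B) ->
  exists2 M : R, 0 <= M & Linfty_norm f = M%:E.
Proof.
move=> fB.
have f0 : (0 <= Linfty_norm f)%E by exact: Lnorm_ge0.
have : (Linfty_norm f <= B%:E)%E.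
  by rewrite Linfty_normE; apply/ess_supP; apply: aeW => t /=; rewrite lee_fin.
case: (Linfty_norm f) f0 => [M| |] //= M0 _.
by exists M.
Qed.

Lemma Linfty_norm_le_interior f K : 0 <= K ->
  (forall t, -1 < t < 1 -> `|f t| <= K) -> (Linfty_norm f <= K%:E)%E.
Proof.
move=> K0 fK; rewrite Linfty_normE; apply/ess_supP.
have E0 : mu.-negligible [set -1; (1 : R)].
  apply/negligibleP; first exact: measurableU.
  apply: countable_lebesgue_measure0; apply: finite_set_countable.
  exact: finite_set2.
apply: negligibleS E0 => t /= tK; apply: contrapT => t11; apply: tK.
rewrite lee_fin zero_extE.
case: ifPn => [/andP[t1 t2]|_]; last by rewrite normr0.
apply: fK; rewrite !lt_neqAle t1 t2 !andbT.
by apply/andP; split; apply/eqP => tE; apply: t11; [left|right].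
Qed.

End EssentialSupremum.

(** * The error bound *)

Theorem theorem5p1 (R : realType) (k N : nat) (alpha : R) (u : R -> R)
    (x : nat -> R) (uNB : {poly R})
    (halpha : k%:R < alpha < k.+1%:R)
    (hu : analytic_on u `[-1, 1])
    (hN : (2 * k + 1 <= N)%N)
    (hx : hermite_nodes k (N - 2 * k - 1) x)
    (huNB : hermite_interpolant k N x u uNB) :
  let e := fun t : R => u t - uNB.[t] in
  let gamma := k.+1%:R - alpha in
  let C_R := Num.max (riesz_c1 gamma) (riesz_c2 gamma) in
  derivable_upto k.+1 (riesz_potential k alpha e) (`]-1, 1[ : set R) /\
  (Linfty_norm (riesz_deriv k alpha e) <=
     (2 * C_R / Gamma (k.+2%:R - alpha))%:E * Linfty_norm (derive1n k.+1 e))%E.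
Proof.
move=> e g C_R.
have g01 : 0 < g < 1 by move: halpha; rewrite /g -natr1; lra.
have ab : (-1 : R) <= 1 by lra.
have se0 t : -1 <= t <= 1 -> smooth_near u t.
  by move=> t11; apply: (analytic_smooth_near hu); rewrite /= in_itv.
have se t : -1 <= t <= 1 -> smooth_near e t.
  by move=> /se0 /(smooth_near_subr_horner uNB)[].
have e0 j : (j <= k)%N -> derive1n j e (-1) = 0 /\ derive1n j e 1 = 0.
  move=> jk; have [_ ejk _] := huNB; have [em ep] := ejk j jk.
  split.
    have [|_ ->] := smooth_near_subr_horner uNB (se0 (-1) _); first by lra.
    by rewrite em subrr.
  have [|_ ->] := smooth_near_subr_horner uNB (se0 1 _); first by lra.
  by rewrite ep subrr.
have de j t : -1 <= t <= 1 -> derivable (derive1n j e) t 1.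
  by move=> /(smooth_near_is_derive se j)[].
have me j : measurable_fun [set: R] (derive1n j e \_ `[-1, 1]).
  exact: measurable_zero_ext (de j).
have bnd j : exists B, forall t, `|(derive1n j e \_ `[-1, 1]) t| <= B.
  have [B eB] := derivable_itv_bounded ab (de j).
  by exists B; exact: zero_ext_bounded.
have iW := integrable_riesz_kernel k g01.
have oI : open (`]-1, 1[%classic : set R) by exact: interval_open.
have [B0 eB0] := bnd 0%N.
have pot : {in (`]-1, 1[%classic : set R),
    convolution (e \_ `[-1, 1]) (riesz_kernel k g) =1
    riesz_potential k alpha e}.
  move=> t; rewrite inE/= in_itv/= => t11.
  by rewrite (riesz_potential_convolution t11 g01 (me 0%N) eB0).
split.
  apply: derivable_upto_eq_open oI pot _.
  exact: derivable_upto_convolution ab se e0 iW _.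
have [B eB] := bnd k.+1.
have [M M0 eM] := Linfty_norm_fin eB.
have aeM := Linfty_norm_ge (derive1n k.+1 e).
have c_le : riesz_const k g <= C_R.
  by rewrite /riesz_const /C_R le_max; case: ifP => _; rewrite lexx ?orbT.
have C0 : 0 <= C_R.
  by rewrite /C_R le_max ltW// riesz_c1_gt0.
have -> : k.+2%:R - alpha = g + 1 by rewrite /g -[k.+2%:R]natr1; ring.
rewrite eM -EFinM; apply: Linfty_norm_le_interior.
  by rewrite mulr_ge0// divr_ge0 ?Gamma_ge0// mulr_ge0.
move=> t t11.
have tI : t \in (`]-1, 1[%classic : set R) by rewrite inE/= in_itv.
rewrite /riesz_deriv -(derive1n_eq_open oI pot)//.
rewrite (derive1n_convolution ab se e0 iW)//.
apply: (le_trans (norm_convolution_riesz_kernel g01 _ _ (M := M) _ _)) => //.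
- by lra.
- exact: integrable_convolution (me _) eB iW.
- by apply: ae_imp aeM => s; rewrite eM lee_fin.
- by rewrite ler_wpM2r// ler_wpM2r ?invr_ge0 ?Gamma_ge0// ler_wpM2l.
Qed.
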